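(* Let $L$ be a finite join-semidistributive (resp. meet-semidistributive) lattice. Then $L$ is meet-distributive (resp. join-distributive) if and only if its maximal-chain exchange graph $G(L)$ is connected.
   Context: All lattices are finite. For a lattice $L$, $\widehat 0$ denotes its minimum, $x\lessdot y$ means that $y$ covers $x$, and $[x,y]=\{z\in L: x\le z\le y\}$. $L$ is join-semidistributive if for all $a,b,c\in L$, $a\vee b=a\vee c$ implies $a\vee(b\wedge c)=a\vee b$; it is meet-semidistributive if the dual condition holds ($a\wedge b=a\wedge c$ implies $a\wedge(b\vee c)=a\wedge b$). $L$ is meet-distributive if for every $x\in L\setminus\{\widehat 0\}$ the interval $[x_\downarrow,x]$ is a Boolean lattice, where $x_\downarrow:=\bigwedge\{y\in L: y\lessdot x\}$; it is join-distributive if the dual lattice (reversed order) is meet-distributive. The maximal-chain exchange graph $G(L)$ is the graph whose vertices are the maximal chains of $L$ (chains maximal under inclusion), two maximal chains $C,C'$ being adjacent when $|C\setminus C'|=|C'\setminus C|=1$. *)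

(* Defs.v *)
From mathcomp Require Import all_boot all_order.

Set Implicit Arguments.
Unset Strict Implicit.
Unset Printing Implicit Defensive.

Import Order.TTheory.
Local Open Scope order_scope.

Definition join_semidistributive {d} (L : latticeType d) : Prop :=
  forall a b c : L, a `|` b = a `|` c -> a `|` (b `&` c) = a `|` b.

Definition meet_semidistributive {d} (L : latticeType d) : Prop :=
  forall a b c : L, a `&` b = a `&` c -> a `&` (b `|` c) = a `&` b.

Definition covered_by {d} {L : finTBLatticeType d} (x y : L) : bool :=
  (x < y) && [forall z : L, ~~ (x < z < y)].

Definition lower_covers_meet {d} {L : finTBLatticeType d} (x : L) : L :=
  \meet_(y : L | covered_by y x) y.

(* A Boolean lattice is a complemented distributive lattice. The interval
   [u, v] is a sublattice, so its operations are those of L, while its bounds,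
   and hence the complements, are taken relative to u and v. *)
Definition boolean_interval {d} {L : finTBLatticeType d} (u v : L) : Prop :=
  [/\ u <= v,
      forall a b c : L, u <= a <= v -> u <= b <= v -> u <= c <= v ->
        a `&` (b `|` c) = (a `&` b) `|` (a `&` c)
    & forall a : L, u <= a <= v ->
        exists b : L, [/\ u <= b <= v, a `&` b = u & a `|` b = v]].

Definition meet_distributive {d} (L : finTBLatticeType d) : Prop :=
  forall x : L, x != \bot -> boolean_interval (lower_covers_meet x) x.

Definition join_distributive {d} (L : finTBLatticeType d) : Prop :=
  meet_distributive L^d.

Definition is_chain {d} {L : finTBLatticeType d} (C : {set L}) : bool :=
  [forall x in C, forall y in C, x >=< y].

Definition maximal_chain {d} (L : finTBLatticeType d) : finType :=
  {C : {set L} | maxset is_chain C}.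

Definition chain_exchange {d} (L : finTBLatticeType d) : rel (maximal_chain L) :=
  fun C C' => (#|val C :\: val C'| == 1%N) && (#|val C' :\: val C| == 1%N).

(* The graph always has a vertex, so no nonemptiness clause is needed. *)
Definition exchange_graph_connected {d} (L : finTBLatticeType d) : Prop :=
  forall C C' : maximal_chain L, connect (@chain_exchange d L) C C'.

(* Main.v *)
Require Import Defs.
From mathcomp Require Import all_boot all_order.

(** Why the theorem holds.

    The two halves are dual to each other, since a lattice and its dual have
    the same maximal chains, so consider the join-semidistributive half.

    Meet-distributivity implies connectedness without any semidistributivity.
    The interval from the meet of the lower covers of x up to x is
    distributive, so two distinct lower covers y, z of x both cover their meet
    ([meet_distributive_lower_semimodular]).  Two maximal chains that agree
    above x are then joined by induction on x ([connect_agree_above]): if they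
    descend from x to y and to z, detour through a chain containing
    y /\ z < y < x and swap y for z in it.

    For the converse, join-semidistributivity gives each cover y < x a label:
    the least w with y \/ w = x.  It satisfies w <= x but not w <= y.
    Exchanging two maximal chains moves one element across a diamond, and
    opposite sides of a diamond carry the same label ([edge_label_square]), so
    an exchange preserves the set of labels of a chain.  If the exchange graph
    is connected, all maximal chains therefore carry all labels of L.  Reading
    this on a chain through a cover y < x shows that the only label lying
    below x and not below y is the label of that cover
    ([connected_label_unique]).  As labels also separate elements
    ([label_separates]), an element b between x_* and x, where x_* is the meet
    of the lower covers of x, is determined by which of the labels of the
    covers z < x lie below it, namely those with b not below z.  So the
    interval behaves like a family of subsets closed under the Boolean
    operations ([connected_meet_distributive]). *)

Set Implicit Arguments.
Unset Strict Implicit.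
Unset Printing Implicit Defensive.

Import Order.TTheory.
Local Open Scope order_scope.

(** * Covers in a finite lattice *)

Section Lattice.
Context {d : Order.disp_t} {L : finTBLatticeType d}.
Implicit Types (a b c x y z s t w : L) (C D : {set L}).

(** Counting the elements below a point is strictly monotone, so a point of P
    with the largest count is maximal in P. *)
Lemma finite_maximal (P : pred L) x :
  P x -> exists2 m, P m & forall t, P t -> m <= t -> t = m.
Proof.
move=> Px; pose F t := #|[set z | z <= t]|.
case: (@arg_maxnP _ x P F Px) => m Pm max_m; exists m => // t Pt le_mt.
apply/eqP; rewrite eq_le le_mt andbT.
have sub_mt : [set z | z <= m] \subset [set z | z <= t].
  by apply/subsetP => z; rewrite !inE => /le_trans; apply.
have /eqP eq_mt : [set z | z <= m] == [set z | z <= t].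
  by rewrite eqEcard sub_mt; exact: max_m Pt.
by have := lexx t; have := in_set (fun z => z <= t) t; rewrite -eq_mt inE => ->.
Qed.

Lemma coveredP x y :
  reflect (x < y /\ forall z, x <= z -> z <= y -> z = x \/ z = y)
          (covered_by x y).
Proof.
apply: (iffP andP) => -[lt_xy mid]; split=> //.
  move=> z le_xz le_zy; have /forallP/(_ z) := mid.
  rewrite !lt_neqAle le_xz le_zy !andbT negb_and !negbK.
  by case/orP=> /eqP->; [left | right].
apply/forallP => z; apply/negP => /andP[lt_xz lt_zy].
have [eq_z | eq_z] := mid z (ltW lt_xz) (ltW lt_zy); move: lt_xz lt_zy.
  by rewrite eq_z ltxx.
by rewrite eq_z ltxx.
Qed.

Lemma covered_lt x y : covered_by x y -> x < y.
Proof. by case/coveredP. Qed.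

Lemma covered_above y x : y < x -> exists2 z, covered_by z x & y <= z.
Proof.
move=> lt_yx; have [|z /andP[le_yz lt_zx] max_z] :=
  @finite_maximal [pred z | (y <= z) && (z < x)] y; first by rewrite /= lexx.
exists z => //; apply/coveredP; split=> // t le_zt le_tx.
have [->|ne_tx] := eqVneq t x; [by right | left].
by apply: max_z => //=; rewrite (le_trans le_yz) // lt_neqAle ne_tx.
Qed.

Lemma covered_meet_join x y z :
  covered_by y x -> z <= x -> ~~ (z <= y) -> y `|` z = x.
Proof.
move=> /coveredP[lt_yx mid] le_zx nle_zy.
have [|eq_y|//] := mid (y `|` z) (leUl _ _); first by rewrite leUx le_zx ltW.
by case/negP: nle_zy; rewrite -eq_y leUr.
Qed.

Lemma lower_cover_incomparable x y z :
  covered_by y x -> covered_by z x -> y != z -> ~~ (y <= z).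
Proof.
move=> /coveredP[lt_yx mid] cov_zx /eqP ne_yz; apply/negP => le_yz.
have [/esym//|eq_zx] := mid z le_yz (ltW (covered_lt cov_zx)).
by have := covered_lt cov_zx; rewrite eq_zx ltxx.
Qed.

(** * Maximal chains *)

Lemma chainP C : reflect {in C &, forall x y, (x <= y) || (y <= x)} (is_chain C).
Proof.
apply: (iffP forall_inP) => [chC x y Cx Cy | chC x Cx].
  by have /forall_inP/(_ y Cy) := chC x Cx.
by apply/forall_inP => y Cy; apply: chC.
Qed.

Lemma maxchain_total C : maxset is_chain C ->
  {in C &, forall x y, (x <= y) || (y <= x)}.
Proof. by move=> /maxsetp/chainP. Qed.

(** Maximality is used through this saturation property: adding s to C gives a
    chain, which cannot be larger than C. *)
Lemma maxchain_mem C s : maxset is_chain C ->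
  {in C, forall t, (s <= t) || (t <= s)} -> s \in C.
Proof.
move=> maxC cmp_s; have chC := maxchain_total maxC.
have [_ max_C] := maxsetP maxC.
rewrite -(max_C (s |: C)) ?setU11 ?subsetUr //.
apply/chainP => x y /setU1P[->|Cx] /setU1P[->|Cy]; rewrite ?lexx ?cmp_s //.
  by rewrite orbC cmp_s.
exact: chC.
Qed.

Lemma maxchain_intro C : is_chain C ->
  (forall s, {in C, forall t, (s <= t) || (t <= s)} -> s \in C) ->
  maxset is_chain C.
Proof.
move=> chC memC; apply/maxsetP; split=> // D chD sub_CD.
apply/eqP; rewrite eqEsubset sub_CD andbT; apply/subsetP => s Ds.
by apply: memC => t Ct; have/chainP := chD; apply=> //; apply: (subsetP sub_CD).
Qed.

Lemma maxchain_exists C : is_chain C ->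
  exists2 D, maxset is_chain D & C \subset D.
Proof. by move=> chC; have [D maxD CD] := maxset_exists chC; exists D. Qed.

Lemma maxchain_top C : maxset is_chain C -> \top \in C.
Proof. by move=> maxC; apply: maxchain_mem => // t _; rewrite lex1 orbT. Qed.

Lemma maxchain_bot C : maxset is_chain C -> \bot \in C.
Proof. by move=> maxC; apply: maxchain_mem => // t _; rewrite le0x. Qed.

(** Anything between two consecutive elements of C is comparable with all of C,
    hence already lies in C. *)
Lemma maxchain_covered C a b : maxset is_chain C ->
  a \in C -> b \in C -> a < b ->
  {in C, forall t, t <= a \/ b <= t} -> covered_by a b.
Proof.
move=> maxC Ca Cb lt_ab gap; apply/coveredP; split=> // z le_az le_zb.
have Cz : z \in C.
  apply: maxchain_mem => // t /gap[le_ta | le_bt].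
    by rewrite (le_trans le_ta le_az) orbT.
  by rewrite (le_trans le_zb le_bt).
by have [le_za|le_bz] := gap z Cz; [left | right]; apply: le_anti;
  apply/andP.
Qed.

Lemma maxchain_pred C x : maxset is_chain C -> x \in C -> x != \bot ->
  exists a, [/\ a \in C, covered_by a x & {in C, forall t, t <= a \/ x <= t}].
Proof.
move=> maxC Cx x_neq0; have chC := maxchain_total maxC.
have [|a /andP[Ca lt_ax] max_a] := @finite_maximal [pred t in C | t < x] \bot.
  by rewrite /= maxchain_bot // lt0x.
have gap : {in C, forall t, t <= a \/ x <= t}.
  move=> t Ct; have [le_xt|nle_xt] := boolP (x <= t); [by right | left].
  have le_tx : t <= x by have := chC _ _ Ct Cx; rewrite (negPf nle_xt) orbF.
  have lt_tx : t < x by rewrite lt_leAnge le_tx.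
  have /orP[//|le_at] := chC _ _ Ct Ca.
  by rewrite (max_a t) //= Ct lt_tx.
by exists a; split=> //; apply: (maxchain_covered maxC).
Qed.

Lemma maxchain_succ C x : maxset is_chain C -> x \in C -> x != \top ->
  exists b, [/\ b \in C, covered_by x b & {in C, forall t, t <= x \/ b <= t}].
Proof.
move=> maxC Cx x_neq1; have chC := maxchain_total maxC.
pose b := \meet_(t in C | x < t) t.
have gap : {in C, forall t, t <= x \/ b <= t}.
  move=> t Ct; have [le_tx|nle_tx] := boolP (t <= x); [by left | right].
  have le_xt : x <= t by have := chC _ _ Ct Cx; rewrite (negPf nle_tx).
  by apply: meets_inf; rewrite Ct lt_leAnge le_xt.
have [Cb lt_xb] : b \in C /\ x < b.
  apply: (big_ind (fun z => z \in C /\ x < z)).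
  - by rewrite maxchain_top // ltx1.
  - move=> s t [Cs lt_xs] [Ct lt_xt].
    by case/orP: (chC _ _ Cs Ct) => [/meet_idPl|/meet_idPr] ->.
  - by move=> t /andP[].
by exists b; split=> //; apply: (maxchain_covered maxC).
Qed.

(** * Lower semimodularity makes the exchange graph connected *)

(** If y /\ z <= s <= y and s is not below z, then z \/ s = x, and expanding
    y = y /\ (z \/ s) by distributivity collapses it to s. *)
Lemma meet_distributive_lower_semimodular x y z : meet_distributive L ->
  covered_by y x -> covered_by z x -> y != z -> covered_by (y `&` z) y.
Proof.
move=> mdL cov_y cov_z ne_yz.
have lt_yx := covered_lt cov_y; have lt_zx := covered_lt cov_z.
have x_neq0 : x != \bot by rewrite -lt0x (le_lt_trans (le0x y)).
have [le_ux distr _] := mdL x x_neq0.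
have le_uy : lower_covers_meet x <= y by apply: meets_inf.
have le_uz : lower_covers_meet x <= z by apply: meets_inf.
have nle_yz := lower_cover_incomparable cov_y cov_z ne_yz.
apply/coveredP; split=> [|s le_ws le_sy].
  by rewrite lt_neqAle leIl andbT eq_meetl.
have le_us : lower_covers_meet x <= s.
  by apply: le_trans le_ws; rewrite lexI le_uy.
have [le_sz|nle_sz] := boolP (s <= z).
  by left; apply: le_anti; rewrite le_ws lexI le_sy le_sz.
right; have le_sx := le_trans le_sy (ltW lt_yx).
have := distr y z s; rewrite le_uy le_uz le_us le_sx !ltW //.
rewrite (covered_meet_join cov_z) //.
move/(_ isT isT isT); rewrite (meet_idPl (ltW lt_yx)) (meet_idPr le_sy).
by rewrite (join_idPr le_ws).
Qed.

(** Both sides of the diamond w < y, z < x are tight, so every element of D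
    other than y is at most w or at least x, and the same holds for any element
    other than z that is comparable with the modified chain. *)
Lemma maxchain_swap D x y z w : maxset is_chain D ->
  x \in D -> y \in D -> w \in D -> covered_by w y -> covered_by y x ->
  covered_by w z -> covered_by z x ->
  maxset is_chain (z |: D :\ y).
Proof.
move=> maxD Dx Dy Dw cov_wy cov_yx cov_wz cov_zx.
have chD := maxchain_total maxD.
have [[lt_wy mid_wy] [lt_yx mid_yx]] := (coveredP _ _ cov_wy, coveredP _ _ cov_yx).
have [[lt_wz mid_wz] [lt_zx mid_zx]] := (coveredP _ _ cov_wz, coveredP _ _ cov_zx).
have gap t : t \in D -> t != y -> t <= w \/ x <= t.
  move=> Dt ne_ty.
  have /orP[le_ty|le_yt] := chD _ _ Dt Dy.
    have /orP[le_tw|le_wt] := chD _ _ Dt Dw; first by left.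
    by have [->|eq_ty] := mid_wy t le_wt le_ty; [left | rewrite eq_ty eqxx in ne_ty].
  have /orP[le_xt|le_tx] := chD _ _ Dx Dt; first by right.
  by have [eq_ty|->] := mid_yx t le_yt le_tx; [rewrite eq_ty eqxx in ne_ty | right].
have cmp_z t : t \in D -> t != y -> (t <= z) || (z <= t).
  move=> Dt ne_ty; have [le_tw|le_xt] := gap t Dt ne_ty.
    by rewrite (le_trans le_tw (ltW lt_wz)).
  by rewrite (le_trans (ltW lt_zx) le_xt) orbT.
apply: maxchain_intro.
  apply/chainP => s t /setU1P[->|/setD1P[ne_s Ds]] /setU1P[->|/setD1P[ne_t Dt]].
  - by rewrite lexx.
  - by rewrite orbC cmp_z.
  - exact: cmp_z.
  - exact: chD.
move=> s cmp_s; rewrite !inE.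
have cmp_sz : (s <= z) || (z <= s) by apply: cmp_s; rewrite setU11.
have mem_w : w \in z |: D :\ y by rewrite !inE Dw (lt_eqF lt_wy) orbT.
have mem_x : x \in z |: D :\ y by rewrite !inE Dx (gt_eqF lt_yx) orbT.
have [//|ne_sz] := eqVneq s z; rewrite /=.
have gap_s : s <= w \/ x <= s.
  have /orP[le_sz|le_zs] := cmp_sz.
    have /orP[le_sw|le_ws] := cmp_s w mem_w; first by left.
    by have [->|/eqP] := mid_wz s le_ws le_sz; [left | rewrite (negPf ne_sz)].
  have /orP[le_sx|le_xs] := cmp_s x mem_x; last by right.
  by have [/eqP|->] := mid_zx s le_zs le_sx; [rewrite (negPf ne_sz) | right].
apply/andP; split.
  apply/eqP => eq_sy.
  by case: gap_s; rewrite eq_sy (lt_geF lt_wy, lt_geF lt_yx).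
apply: maxchain_mem => // t Dt; have [->|ne_ty] := eqVneq t y.
  case: gap_s => [le_sw|le_xs]; first by rewrite (le_trans le_sw (ltW lt_wy)).
  by rewrite (le_trans (ltW lt_yx) le_xs) orbT.
by apply: cmp_s; rewrite !inE ne_ty Dt orbT.
Qed.


Lemma maxchain_agree_cover C D x y : maxset is_chain C -> maxset is_chain D ->
  covered_by y x -> x \in C -> x \in D -> y \in C -> y \in D ->
  (forall t, x <= t -> (t \in C) = (t \in D)) ->
  forall t, y <= t -> (t \in C) = (t \in D).
Proof.
move=> maxC maxD /coveredP[_ mid] Cx Dx Cy Dy agree t le_yt.
have [/agree//|nle_xt] := boolP (x <= t).
have chain_case E : maxset is_chain E -> x \in E -> t \in E -> t = y.
  move=> /maxchain_total chE Ex Et.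
  have le_tx : t <= x by have := chE _ _ Et Ex; rewrite (negPf nle_xt) orbF.
  by have [//|eq_tx] := mid t le_yt le_tx; rewrite eq_tx lexx in nle_xt.
by apply/idP/idP => Et; rewrite (chain_case _ _ _ Et).
Qed.

(** The detour of the connectivity proof: keep C above x but descend through y
    and w. *)
Lemma maxchain_extend_above C x y w : maxset is_chain C ->
  x \in C -> y <= x -> w <= y ->
  exists D, [/\ maxset is_chain D, y \in D, w \in D
              & forall t, x <= t -> (t \in C) = (t \in D)].
Proof.
move=> maxC Cx le_yx le_wy; have chC := maxchain_total maxC.
pose A := [set t in C | x <= t] :|: [set y; w].
have chA : is_chain A.
  have lowA s t : t \in [set y; w] -> x <= s -> t <= s.
    move=> + le_xs; rewrite !inE => /orP[] /eqP->.
      exact: le_trans le_xs.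
    exact: le_trans (le_trans le_wy le_yx) le_xs.
  apply/chainP => s t /setUP[/setIdP[Cs le_xs]|As] /setUP[/setIdP[Ct le_xt]|At].
  - exact: chC.
  - by rewrite (lowA s t) ?orbT.
  - by rewrite (lowA t s).
  - move: As At; rewrite !inE => /orP[] /eqP-> /orP[] /eqP->;
      by rewrite ?lexx ?le_wy ?orbT.
have [D maxD sub_AD] := maxchain_exists chA.
have chD := maxchain_total maxD.
exists D; split=> //; try by apply: (subsetP sub_AD); rewrite !inE eqxx ?orbT.
move=> t le_xt; apply/idP/idP => [Ct|Dt].
  by apply: (subsetP sub_AD); rewrite !inE Ct le_xt.
apply: maxchain_mem => // s Cs.
have /orP[le_xs|le_sx] := chC _ _ Cx Cs.
  by apply: chD => //; apply: (subsetP sub_AD); rewrite !inE Cs le_xs.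
by rewrite (le_trans le_sx le_xt) orbT.
Qed.

(** Agreement above x is the induction invariant: it says that the two chains
    only differ in the interval below x, without having to speak of maximal
    chains of that interval.  The induction is on the number of elements
    strictly below x. *)
Lemma connect_agree_above : meet_distributive L ->
  forall x (C C' : maximal_chain L), x \in val C -> x \in val C' ->
  (forall t, x <= t -> (t \in val C) = (t \in val C')) ->
  connect (@chain_exchange d L) C C'.
Proof.
move=> mdL x; have [n] := ubnP #|[set z | z < x]|.
elim: n x => // n IHn x lt_xn C C' Cx C'x agree.
have IH y : covered_by y x -> forall D D' : maximal_chain L,
    x \in val D -> x \in val D' -> y \in val D -> y \in val D' ->
    (forall t, x <= t -> (t \in val D) = (t \in val D')) ->
    connect (@chain_exchange d L) D D'.
  move=> cov_yx D D' Dx D'x Dy D'y agr; have lt_yx := covered_lt cov_yx.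
  apply: (IHn y _ D D' Dy D'y);
    last exact: maxchain_agree_cover (valP D) (valP D') cov_yx Dx D'x Dy D'y agr.
  apply: (leq_trans _ (lt_xn : (_ <= n)%N)); apply: proper_card.
  apply/properP; split.
    by apply/subsetP => t; rewrite !inE => /lt_trans; apply.
  by exists y; rewrite inE ?ltxx.
have [x0|x_neq0] := eqVneq x \bot.
  suff -> : C = C' by exact: connect0.
  by apply/val_inj/setP => t; apply: agree; rewrite x0 le0x.
have [y [Cy cov_yx _]] := maxchain_pred (valP C) Cx x_neq0.
have [z [C'z cov_zx _]] := maxchain_pred (valP C') C'x x_neq0.
have [eq_yz|ne_yz] := eqVneq y z; first by apply: (IH y); rewrite // eq_yz.
have lt_yx := covered_lt cov_yx; have lt_zx := covered_lt cov_zx.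
have cov_wy := meet_distributive_lower_semimodular mdL cov_yx cov_zx ne_yz.
have cov_wz : covered_by (y `&` z) z.
  rewrite meetC; apply: meet_distributive_lower_semimodular cov_yx _ => //.
  by rewrite eq_sym.
have [D [maxD Dy Dw agrD]] :=
  maxchain_extend_above (valP C) Cx (ltW lt_yx) (leIl y z).
have Dx : x \in D by rewrite -agrD.
(* The path is C - D - D' - C', where D leaves x through y, D' leaves it
   through z, and both continue through the meet of y and z. *)
have maxD' := maxchain_swap maxD Dx Dy Dw cov_wy cov_yx cov_wz cov_zx.
have nDz : z \notin D.
  apply/negP => Dz; have := maxchain_total maxD Dy Dz.
  rewrite (negPf (lower_cover_incomparable cov_yx cov_zx ne_yz)).
  by rewrite (negPf (lower_cover_incomparable cov_zx cov_yx _)) // eq_sym.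
have agrD' t : x <= t -> (t \in D) = (t \in z |: D :\ y).
  by move=> le_xt; rewrite !inE !gt_eqF ?(lt_le_trans _ le_xt).
apply: (@connect_trans _ _ (Sub D maxD)).
  by apply: (IH y); rewrite ?SubK.
apply: (@connect_trans _ _ (Sub (z |: D :\ y) maxD')).
  apply: connect1; rewrite /chain_exchange !SubK; apply/andP; split.
    apply/cards1P; exists y; apply/setP => t; rewrite !inE.
    have [->|ne_ty] := eqVneq t y; first by rewrite Dy /= (negPf ne_yz).
    by case: (t \in D); rewrite ?orbT ?andbF.
  apply/cards1P; exists z; apply/setP => t; rewrite !inE.
  by have [->|ne_tz] := eqVneq t z; rewrite ?nDz //=; case: (t \in D); rewrite ?andbF.
apply: (IH z); rewrite ?SubK ?setU11 -?agrD' //.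
by move=> t le_xt; rewrite -agrD' // -agrD ?agree.
Qed.

Lemma meet_distributive_connected :
  meet_distributive L -> exchange_graph_connected L.
Proof.
move=> mdL C C'; apply: (connect_agree_above mdL (x := \top)) => [||t].
- exact: maxchain_top (valP C).
- exact: maxchain_top (valP C').
- rewrite le1x => /eqP->; rewrite !maxchain_top //; [exact: valP C' | exact: valP C].
Qed.

(** * Edge labels in a join-semidistributive lattice *)

Definition edge_label y x : L := \meet_(w | y `|` w == x) w.

Lemma edge_label_min y x w : y `|` w = x -> edge_label y x <= w.
Proof. by move=> eq_x; apply: meets_inf; rewrite eq_x. Qed.

Lemma edge_label_le y x : y <= x -> edge_label y x <= x.
Proof. by move=> le_yx; apply: edge_label_min; apply/join_idPr. Qed.

(** The set of w with y \/ w = x is closed under meets by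
    join-semidistributivity, so the meet of the set belongs to it. *)
Lemma join_edge_label y x : join_semidistributive L ->
  y <= x -> y `|` edge_label y x = x.
Proof.
move=> jsd le_yx; rewrite -(meet_idPl (edge_label_le le_yx)) /edge_label.
apply: (big_ind (fun m => y `|` (m `&` x) = x)).
(* The empty meet is the top element, which need not satisfy y \/ w = x;
   cutting down by x repairs this base case. *)
- by rewrite meet1x; apply/join_idPr.
- move=> a b eq_a eq_b.
  have -> : a `&` b `&` x = (a `&` x) `&` (b `&` x) by rewrite meetACA meetxx.
  by rewrite jsd eq_a.
- by move=> w /eqP <-; rewrite (meet_idPl (leUr _ _)).
Qed.

Lemma edge_label_nle y x : join_semidistributive L ->
  covered_by y x -> ~~ (edge_label y x <= y).
Proof.
move=> jsd /covered_lt lt_yx; apply/negP => /join_idPl.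
by rewrite join_edge_label ?ltW // => eq_xy; rewrite eq_xy ltxx in lt_yx.
Qed.

(** Joining z with the label p of a < y gives y \/ z = x, so the label q of
    z < x is at most p.  Conversely q <= y is not below z, hence not below a,
    so a \/ q = y and p <= q. *)
Lemma edge_label_square a y z x : join_semidistributive L ->
  covered_by a y -> covered_by y x -> covered_by a z -> covered_by z x ->
  y != z -> edge_label a y = edge_label z x.
Proof.
move=> jsd cov_ay cov_yx cov_az cov_zx ne_yz.
have [le_ay le_az] := (ltW (covered_lt cov_ay), ltW (covered_lt cov_az)).
have [le_yx le_zx] := (ltW (covered_lt cov_yx), ltW (covered_lt cov_zx)).
have zy_x : z `|` y = x.
  by apply: covered_meet_join => //; apply: lower_cover_incomparable cov_zx _.
have le_label : edge_label z x <= edge_label a y.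
  apply: edge_label_min.
  by rewrite -(join_idPl le_az) -joinA join_edge_label.
apply: le_anti; rewrite le_label andbT; apply: edge_label_min.
apply: covered_meet_join => //.
  exact: le_trans le_label (edge_label_le le_ay).
apply: contra (edge_label_nle jsd cov_zx); move=> /le_trans; exact.
Qed.

Definition chain_has_label w C :=
  [exists a in C, exists b in C, covered_by a b && (edge_label a b == w)].

Lemma chain_has_labelP w C :
  reflect (exists a b, [/\ a \in C, b \in C, covered_by a b & edge_label a b = w])
          (chain_has_label w C).
Proof.
apply: (iffP exists_inP) => [[a Ca /exists_inP[b Cb /andP[cov /eqP eq_w]]]|].
  by exists a, b.
case=> a [b [Ca Cb cov eq_w]]; exists a => //; apply/exists_inP; exists b => //.
by rewrite cov eq_w eqxx.
Qed.

(** The neighbours a and x of y in C survive in C'.  The new element y' cannot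
    be comparable with y, since it would then be comparable with all of C; so
    it has to sit strictly between a and x as well. *)
Lemma exchange_diamond C C' y y' : maxset is_chain C -> maxset is_chain C' ->
  C :\: C' = [set y] -> C' :\: C = [set y'] ->
  exists a x, [/\ a \in C', x \in C',
    covered_by a y /\ covered_by y x, covered_by a y' /\ covered_by y' x
  & {in C, forall t, t <= a \/ t = y \/ x <= t}].
Proof.
move=> maxC maxC' eq_y eq_y'.
have [chC chC'] := (maxchain_total maxC, maxchain_total maxC').
have /setDP[Cy nC'y] : y \in C :\: C' by rewrite eq_y inE.
have /setDP[C'y' nCy'] : y' \in C' :\: C by rewrite eq_y' inE.
have keep t : t \in C -> t != y -> t \in C'.
  move=> Ct; apply: contraNT => nC't.
  by have : t \in C :\: C' by [rewrite inE nC't]; rewrite eq_y inE.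
have keep' t : t \in C' -> t != y' -> t \in C.
  move=> C't; apply: contraNT => nCt.
  by have : t \in C' :\: C by [rewrite inE nCt]; rewrite eq_y' inE.
have y_neq0 : y != \bot by apply: contraNneq nC'y => ->; exact: maxchain_bot.
have y_neq1 : y != \top by apply: contraNneq nC'y => ->; exact: maxchain_top.
have [a [Ca cov_ay below]] := maxchain_pred maxC Cy y_neq0.
have [x [Cx cov_yx above]] := maxchain_succ maxC Cy y_neq1.
have [lt_ay lt_yx] := (covered_lt cov_ay, covered_lt cov_yx).
have C'a : a \in C' by rewrite keep // lt_eqF.
have C'x : x \in C' by rewrite keep // gt_eqF.
have gap : {in C, forall t, t <= a \/ t = y \/ x <= t}.
  move=> t Ct; have [le_ta|le_yt] := below t Ct; first by left.
  right; have [le_ty|le_xt] := above t Ct; [left | by right].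
  by apply: le_anti; rewrite le_ty.
have incomp : ~~ ((y' <= y) || (y <= y')).
  apply: contra nCy' => cmp_y'; apply: maxchain_mem => // t Ct.
  by have [->//|ne_ty] := eqVneq t y; apply: chC' => //; apply: keep.
have lt_ay' : a < y'.
  rewrite lt_leAnge; have le_ay' : ~~ (y' <= a).
    by apply: contra incomp => le_y'a; rewrite (le_trans le_y'a (ltW lt_ay)).
  by rewrite le_ay' andbT; have := chC' _ _ C'a C'y'; rewrite (negPf le_ay') orbF => ->.
have lt_y'x : y' < x.
  rewrite lt_leAnge; have le_y'x : ~~ (x <= y').
    by apply: contra incomp => le_xy'; rewrite (le_trans (ltW lt_yx) le_xy') orbT.
  by rewrite le_y'x andbT; have := chC' _ _ C'y' C'x; rewrite (negPf le_y'x) orbF.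
have gap' t : t \in C' -> t = y' \/ (t <= a \/ x <= t).
  move=> C't; have [->|ne_ty'] := eqVneq t y'; [by left | right].
  have [|[eq_ty|]] := gap t (keep' t C't ne_ty'); [by left | | by right].
  by move: nC'y; rewrite -eq_ty C't.
exists a, x; split=> //; split.
  apply: (maxchain_covered maxC') => // t /gap'[->|[le_ta|le_xt]].
  - by right.
  - by left.
  - by right; apply: le_trans (ltW lt_y'x) le_xt.
apply: (maxchain_covered maxC') => // t /gap'[->|[le_ta|le_xt]].
- by left.
- by left; apply: le_trans le_ta (ltW lt_ay').
- by right.
Qed.

(** Only the covers a < y and y < x are lost, and their labels reappear on the
    opposite sides y' < x and a < y' of the diamond. *)
Lemma exchange_label (C C' : maximal_chain L) w : join_semidistributive L ->
  chain_exchange C C' ->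
  chain_has_label w (val C) -> chain_has_label w (val C').
Proof.
move=> jsd /andP[/cards1P[y eq_y] /cards1P[y' eq_y']].
have [a [x [C'a C'x [cov_ay cov_yx] [cov_ay' cov_y'x] gap]]] :=
  exchange_diamond (valP C) (valP C') eq_y eq_y'.
have /setDP[C'y' nCy'] : y' \in val C' :\: val C by rewrite eq_y' inE.
have /setDP[Cy nC'y] : y \in val C :\: val C' by rewrite eq_y inE.
have ne_yy' : y != y' by apply: contraNneq nC'y => ->.
have keep t : t \in val C -> t != y -> t \in val C'.
  move=> Ct; apply: contraNT => nC't.
  by have : t \in val C :\: val C' by [rewrite inE nC't]; rewrite eq_y inE.
case/chain_has_labelP => u [v [Cu Cv cov_uv eq_w]].
have [lt_uv mid] := coveredP _ _ cov_uv; apply/chain_has_labelP.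
have [eq_uy|ne_uy] := eqVneq u y.
  subst u; have le_xv : x <= v.
    have [le_va|[eq_vy|//]] := gap v Cv.
      by have := lt_trans (le_lt_trans le_va (covered_lt cov_ay)) lt_uv; rewrite ltxx.
    by rewrite eq_vy ltxx in lt_uv.
  have [eq_xy|eq_xv] := mid x (ltW (covered_lt cov_yx)) le_xv.
    by have := covered_lt cov_yx; rewrite eq_xy ltxx.
  exists a, y'; split=> //; rewrite -eq_w -eq_xv.
  by apply: edge_label_square; rewrite // eq_sym.
have [eq_vy|ne_vy] := eqVneq v y; last by exists u, v; rewrite !keep.
subst v; have le_ua : u <= a.
  have [//|[/eqP|le_xu]] := gap u Cu; first by rewrite (negPf ne_uy).
  by have := lt_trans (lt_le_trans (covered_lt cov_yx) le_xu) lt_uv; rewrite ltxx.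
have [eq_au|eq_ay] := mid a le_ua (ltW (covered_lt cov_ay)); last first.
  by have := covered_lt cov_ay; rewrite eq_ay ltxx.
exists y', x; split=> //; rewrite -eq_w -eq_au.
by rewrite (edge_label_square (a := a) (y := y) (z := y') (x := x)).
Qed.

Lemma connected_label (C C' : maximal_chain L) w : join_semidistributive L ->
  exchange_graph_connected L ->
  chain_has_label w (val C) = chain_has_label w (val C').
Proof.
move=> jsd conn.
apply: (closed_connect (a := [pred D | chain_has_label w (val D)])) (conn C C').
move=> D D' exch; apply/idP/idP; apply: exchange_label => //.
by move: exch; rewrite /chain_exchange andbC.
Qed.

(** * Equal label sets force meet-distributivity *)

(** By connectedness, the label of s < t also labels some cover a < b of a
    maximal chain through y and x.  It is at most b and not below a, so b
    cannot be at most y and a cannot be at least x; hence a = y and b = x. *)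
Lemma connected_label_unique s t y x : join_semidistributive L ->
  exchange_graph_connected L -> covered_by s t -> covered_by y x ->
  edge_label s t <= x -> ~~ (edge_label s t <= y) ->
  edge_label s t = edge_label y x.
Proof.
move=> jsd conn cov_st cov_yx le_wx nle_wy.
have pair_chain u v : covered_by u v ->
    exists C : maximal_chain L, u \in val C /\ v \in val C.
  move=> /covered_lt/ltW le_uv; have [|C maxC sub_C] := @maxchain_exists [set u; v].
    apply/chainP => p q; rewrite !inE => /orP[] /eqP-> /orP[] /eqP->;
    by rewrite ?lexx ?le_uv ?orbT.
  by exists (Sub C maxC); rewrite SubK !(subsetP sub_C) // !inE eqxx ?orbT.
have [C [Cs Ct]] := pair_chain s t cov_st.
have [D [Dy Dx]] := pair_chain y x cov_yx.
have chD := maxchain_total (valP D).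
have /chain_has_labelP[a [b [Da Db cov_ab eq_w]]] :
    chain_has_label (edge_label s t) (val D).
  by rewrite -(connected_label C) //; apply/chain_has_labelP; exists s, t.
rewrite -eq_w in le_wx nle_wy *.
have [lt_ab mid_ab] := coveredP _ _ cov_ab.
have [lt_yx mid_yx] := coveredP _ _ cov_yx.
have nle_by : ~~ (b <= y).
  by apply: contra nle_wy; apply: le_trans (edge_label_le (ltW lt_ab)).
have nle_xa : ~~ (x <= a).
  by apply: contra (edge_label_nle jsd cov_ab); apply: le_trans.
have le_yb : y <= b by have := chD _ _ Db Dy; rewrite (negPf nle_by).
have le_ax : a <= x by have := chD _ _ Da Dx; rewrite (negPf nle_xa) orbF.
have le_ya : y <= a.
  have /orP[//|le_ay] := chD _ _ Dy Da.
  by have [->//|eq_yb] := mid_ab y le_ay le_yb; rewrite -eq_yb lexx in nle_by.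
have [eq_ay|eq_ax] := mid_yx a le_ya le_ax; last by rewrite eq_ax lexx in nle_xa.
have le_xb : x <= b.
  have /orP[//|le_bx] := chD _ _ Dx Db.
  have [eq_by|->//] := mid_yx b le_yb le_bx.
  by rewrite eq_by lexx in nle_by.
have [eq_xa|->] := mid_ab x le_ax le_xb; first by rewrite eq_xa lexx in nle_xa.
by rewrite eq_ay.
Qed.

(** Choose a lower cover z of a above a /\ b; the label of z < a works. *)
Lemma label_separates a b : join_semidistributive L -> ~~ (a <= b) ->
  exists s t, [/\ covered_by s t, edge_label s t <= a
                & ~~ (edge_label s t <= b)].
Proof.
move=> jsd nle_ab; have lt_m : a `&` b < a by rewrite lt_neqAle leIl andbT eq_meetl.
have [z cov_za le_mz] := covered_above lt_m.
have le_wa := edge_label_le (ltW (covered_lt cov_za)).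
exists z, a; split=> //; apply: contra (edge_label_nle jsd cov_za) => le_wb.
by apply: le_trans le_mz; rewrite lexI le_wa.
Qed.

(** A label below x that is not below the meet u of the lower covers is the
    label of some z < x, and it lies below a given b in [u, x] exactly when b
    is not below z.  Such labels are therefore join-prime in [u, x], which
    yields distributivity. *)
Lemma connected_meet_distributive : join_semidistributive L ->
  exchange_graph_connected L -> meet_distributive L.
Proof.
move=> jsd conn x x_neq0; set u := lower_covers_meet x.
have label_eq := connected_label_unique jsd conn.
have le_uz z : covered_by z x -> u <= z by move=> cov; apply: meets_inf.
have le_ux : u <= x.
  have [|z cov _] := @covered_above \bot x; first by rewrite lt0x.
  exact: le_trans (le_uz z cov) (ltW (covered_lt cov)).
have below_u s : (forall z, covered_by z x -> s <= z) -> s <= u.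
  by move=> le_s; apply/meetsP.
have label_le b z : covered_by z x -> b <= x -> ~~ (b <= z) -> edge_label z x <= b.
  move=> cov le_bx nle_bz; have [s [t [cov_st le_wb nle_wz]]] := label_separates jsd nle_bz.
  by rewrite -(label_eq s t) // (le_trans le_wb).
have nle_u w : ~~ (w <= u) -> exists2 z, covered_by z x & ~~ (w <= z).
  move=> nle_wu; have [/forall_inP le_w|/forall_inPn[z cov nle]] :=
    boolP [forall (z | covered_by z x), w <= z]; last by exists z.
  by case/negP: nle_wu; apply: below_u.
split=> //.
- move=> a b c /andP[le_ua le_ax] /andP[le_ub le_bx] /andP[le_uc le_cx].
  apply: le_anti; rewrite leUx !leI2 ?leUl ?leUr // !andbT.
  apply/negPn/negP => nle_abc.
  have [s [t [cov_st + nle_w]]] := label_separates jsd nle_abc.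
  rewrite lexI => /andP[le_wa le_wbc].
  have le_wx := le_trans le_wa le_ax.
  have nle_wb : ~~ (edge_label s t <= b).
    by apply: contra nle_w => le_wb; apply: lexUl; rewrite lexI le_wa.
  have nle_wc : ~~ (edge_label s t <= c).
    by apply: contra nle_w => le_wc; apply: lexUr; rewrite lexI le_wa.
  have [|z cov_zx nle_wz] := nle_u (edge_label s t).
    by apply: contra nle_wb => /le_trans; apply.
  have eq_w := label_eq s t z x cov_st cov_zx le_wx nle_wz.
  have : ~~ (b `|` c <= z) by apply: contra nle_wz; apply: le_trans.
  rewrite leUx negb_and => /orP[] /label_le; rewrite -eq_w => le_w.
    by rewrite le_w in nle_wb.
  by rewrite le_w in nle_wc.
- move=> a /andP[le_ua le_ax].
  (* The complement is cut out by the lower covers whose labels lie below a. *)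
  pose b := x `&` \meet_(z | covered_by z x && ~~ (a <= z)) z.
  have le_bx : b <= x by rewrite leIl.
  have le_bz z : covered_by z x -> ~~ (a <= z) -> b <= z.
    by move=> cov nle; apply: le_trans (leIr _ _) _; apply: meets_inf; rewrite cov.
  have le_ub : u <= b.
    by rewrite lexI le_ux; apply/meetsP => z /andP[cov _]; apply: le_uz.
  exists b; split; first by rewrite le_ub.
    apply: le_anti; rewrite lexI le_ua le_ub !andbT; apply: below_u => z cov.
    have [le_az|nle_az] := boolP (a <= z); first by rewrite leIxl.
    by rewrite leIxr // le_bz.
  apply: le_anti; rewrite leUx le_ax le_bx /=.
  apply/negPn/negP => nle_x.
  have [|z cov_zx le_abz] := @covered_above (a `|` b) x.
    by rewrite lt_leAnge nle_x leUx le_ax le_bx.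
  move: le_abz; rewrite leUx => /andP[le_az le_bz'].
  have le_wx := edge_label_le (ltW (covered_lt cov_zx)).
  have nle_wz := edge_label_nle jsd cov_zx.
  have : ~~ (edge_label z x <= b) by apply: contra nle_wz => /le_trans; apply.
  rewrite lexI le_wx /= => /meetsP nall.
  (* Another lower cover z' missing the label of z would have the same label,
     which would then lie below a, hence below z. *)
  apply: nall => z' /andP[cov_z'x nle_az'].
  apply/negPn/negP => nle_wz'; case/negP: nle_wz.
  rewrite (label_eq z x z' x) //; apply: le_trans le_az; exact: label_le.
Qed.

End Lattice.

(** * Duality *)

Lemma exchange_connected_dual (d : Order.disp_t) (L : finTBLatticeType d) :
  exchange_graph_connected L -> exchange_graph_connected L^d.
Proof.
move=> conn.
have maxE (C : {set L}) : @maxset L^d is_chain C = maxset is_chain C.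
  have chE (D : {set L}) : @is_chain _ L^d D = is_chain D.
    by apply/chainP/chainP => chD s t Ds Dt; rewrite orbC; apply: chD.
  by apply/maxsetP/maxsetP => -[chC max_C]; split; rewrite ?chE // -?chE //;
    move=> D chD; apply: max_C; rewrite ?chE // -chE.
pose f (C : maximal_chain L) : maximal_chain L^d :=
  Sub (val C : {set L}) (etrans (maxE _) (valP C)).
have f_onto C : exists D, C = f D.
  have maxC := valP C; have maxC' := maxC; rewrite maxE in maxC'.
  by exists (Sub (val C : {set L}) maxC'); apply: val_inj.
move=> C C'; have [[D ->] [D' ->]] := (f_onto C, f_onto C').
case/connectP: (conn D D') => p; elim: p D => [|E p IHp] D /=.
  by move=> _ ->; exact: connect0.
move=> /andP[exch pth] eq_D'.
apply: connect_trans (IHp E pth eq_D'); exact: connect1.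
Qed.

Theorem theorem3p4 (d : Order.disp_t) (L : finTBLatticeType d) :
  (join_semidistributive L ->
    (meet_distributive L <-> exchange_graph_connected L)) /\
  (meet_semidistributive L ->
    (join_distributive L <-> exchange_graph_connected L)).
Proof.
split=> sd.
  split; [exact: meet_distributive_connected | exact: connected_meet_distributive].
split=> [jdL | conn].
  exact: (@exchange_connected_dual _ L^d (meet_distributive_connected jdL)).
exact: (@connected_meet_distributive _ L^d sd (exchange_connected_dual conn)).
Qed.
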